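(* Let $K\subset\mathbb R^3$ be a nondegenerate tetrahedron with vertices $\boldsymbol x_1,\dots,\boldsymbol x_4$ and let $1\le i<j\le4$. Let $$\boldsymbol\varphi_{e_{ij}}:=\lambda_i\nabla\lambda_j-\lambda_j\nabla\lambda_i+\sum_{l=1}^4\big(c^{ij}_{l,1}\boldsymbol\varphi_{F_l,1}+c^{ij}_{l,2}\boldsymbol\varphi_{F_l,2}\big)$$ with constants $$c^{ij}_{l,1}:=\frac{1}{(\nabla\lambda_{l_1}\times\nabla\lambda_{l_2})\cdot\boldsymbol n_l}(\nabla\lambda_j\times\nabla\lambda_i)\cdot\big((\boldsymbol n_l\times\nabla\lambda_{l_2})\times\boldsymbol n_l\big),$$ $$c^{ij}_{l,2}:=\frac{1}{(\nabla\lambda_{l_2}\times\nabla\lambda_{l_1})\cdot\boldsymbol n_l}(\nabla\lambda_j\times\nabla\lambda_i)\cdot\big((\boldsymbol n_l\times\nabla\lambda_{l_1})\times\boldsymbol n_l\big).$$ Then $$M_{e_{ij}}(\boldsymbol\varphi_{e_{ij}})=1,\qquad M_e(\boldsymbol\varphi_{e_{ij}})=0,\qquad \boldsymbol M_F(\boldsymbol\varphi_{e_{ij}})=\boldsymbol 0$$ for each $e\in\mathcal E(K)\setminus\{e_{ij}\}$ and each $F\in\mathcal F(K)$.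
   Context: $\boldsymbol x_K$ is the barycenter of $K$; $\mathcal E(K)$, $\mathcal F(K)$ are the sets of edges and faces of $K$. $\lambda_1,\dots,\lambda_4$ are the barycentric coordinates with respect to $\boldsymbol x_1,\dots,\boldsymbol x_4$. $F_l$ is the face of $K$ opposite to $\boldsymbol x_l$, with vertices $\boldsymbol x_{l_1},\boldsymbol x_{l_2},\boldsymbol x_{l_3}$, $l_1<l_2<l_3$; $\boldsymbol n_l$ is the unit outward normal to $\partial K$ on $F_l$. $e_{ij}$ is the edge with vertices $\boldsymbol x_i,\boldsymbol x_j$ and $\boldsymbol t_{ij}:=\boldsymbol x_j-\boldsymbol x_i$. For $i=1,2$, $$\boldsymbol\varphi_{F_l,i}:=\tfrac14(8\lambda_l-3)(\boldsymbol x-\boldsymbol x_K)\times(\boldsymbol n_l\times\nabla\lambda_{l_i})+\tfrac14\big((\boldsymbol x_l-\boldsymbol x_K)\cdot\boldsymbol n_l\big)\nabla\lambda_{l_i}+\tfrac1{16}\boldsymbol n_l .$$ The functionals are $$M_{e_{ij}}(\boldsymbol v):=\frac1{|e_{ij}|}\int_{e_{ij}}\boldsymbol v\cdot\boldsymbol t_{ij}\,\mathrm ds,\qquad \boldsymbol M_{F_l}(\boldsymbol v):=\int_{F_l}(\operatorname{curl}\boldsymbol v)\times\boldsymbol n_l\,\mathrm ds.$$ *)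

(* Defs.v *)
From HB Require Import structures.
From mathcomp Require Export all_boot all_order all_algebra.
From mathcomp Require Export all_classical all_reals all_analysis.
Export numFieldNormedType.Exports.

Set Implicit Arguments.
Unset Strict Implicit.
Unset Printing Implicit Defensive.

Import Order.TTheory GRing.Theory Num.Theory.
Local Open Scope classical_set_scope.
Local Open Scope ring_scope.

Section VectorCalculus.
Variable R : realType.
Implicit Types u v a b c y : 'rV[R]_3.

Definition vec3 (r s t : R) : 'rV[R]_3 := \row_k [:: r; s; t]`_k.

Definition dot u v : R := \sum_k u 0 k * v 0 k.

(* Euclidean norm; the library norm `|u| on row vectors is the sup norm. *)
Definition enorm u : R := Num.sqrt (dot u u).

Definition cross u v : 'rV[R]_3 :=
  vec3 (u 0 1 * v 0 2 - u 0 2 * v 0 1)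
       (u 0 2 * v 0 0 - u 0 0 * v 0 2)
       (u 0 0 * v 0 1 - u 0 1 * v 0 0).

Definition pderiv (k : 'I_3) (f : 'rV[R]_3 -> R) y : R :=
  'D_(delta_mx 0 k) f y.

Definition grad (f : 'rV[R]_3 -> R) y : 'rV[R]_3 := \row_k pderiv k f y.

Definition curl (w : 'rV[R]_3 -> 'rV[R]_3) y : 'rV[R]_3 :=
  let d k m := pderiv k (fun z => w z 0 m) y in
  vec3 (d 1 2 - d 2 1) (d 2 0 - d 0 2) (d 0 1 - d 1 0).

(* Arc-length integral of f over the segment [a, b]. *)
Definition segment_int a b (f : 'rV[R]_3 -> R) : R :=
  enorm (b - a) *
  \int[@lebesgue_measure R]_(s in `[0, 1]) f (a + s *: (b - a)).

Definition ref_triangle : set (R * R) :=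
  [set p | 0 <= p.1 /\ 0 <= p.2 /\ p.1 + p.2 <= 1].

(* Surface integral of f over the triangle with vertices a, b, c, pulled back
   to the reference triangle; |(b - a) x (c - a)| is the area element of the
   affine parametrization. *)
Definition triangle_int a b c (f : 'rV[R]_3 -> R) : R :=
  enorm (cross (b - a) (c - a)) *
  \int[(@lebesgue_measure R \x @lebesgue_measure R)%E]_(p in ref_triangle)
     f (a + p.1 *: (b - a) + p.2 *: (c - a)).

Definition triangle_vint a b c (w : 'rV[R]_3 -> 'rV[R]_3) : 'rV[R]_3 :=
  \row_k triangle_int a b c (fun y => w y 0 k).

End VectorCalculus.

Section Tetrahedron.
Variable R : realType.
(* The vertices x_1, .., x_4 are indexed by 'I_4, that is, from 0 to 3. *)
Variable x : 'I_4 -> 'rV[R]_3.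
Implicit Types (y : 'rV[R]_3) (l i j : 'I_4).

Definition nondegenerate : bool :=
  row_free (\matrix_(k < 3) (x (lift ord0 k) - x ord0)).

Definition barycenter : 'rV[R]_3 := 4^-1 *: \sum_l x l.

(* The system  sum_l lambda_l x_l = y,  sum_l lambda_l = 1  reads
   lambda *m bary_mx = (y, 1). *)
Definition bary_mx : 'M[R]_(3 + 1) :=
  \matrix_(l < 4) row_mx (x l) (1 : 'rV[R]_1).

Definition lambda l y : R := (row_mx y (1 : 'rV[R]_1) *m invmx bary_mx) 0 l.

(* lambda_l is affine, so its gradient may be taken at any point
   (see grad_lambdaE). *)
Definition grad_lambda l : 'rV[R]_3 := grad (lambda l) barycenter.

(* face_vtx l k is the k-th vertex index of the face F_l opposite to x_l,
   in increasing order: lift l enumerates the indices different from l. *)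
Definition face_vtx l (k : 'I_3) : 'I_4 := lift l k.

Definition outward_unit_normal l (nl : 'rV[R]_3) : Prop :=
  [/\ enorm nl = 1,
      forall p q, p != l -> q != l -> dot nl (x p - x q) = 0
    & forall p, p != l -> dot nl (x l - x p) < 0].

Definition M_edge i j (v : 'rV[R]_3 -> 'rV[R]_3) : R :=
  (enorm (x j - x i))^-1 *
  segment_int (x i) (x j) (fun y => dot (v y) (x j - x i)).

(* In what follows n l is the unit outward normal on F_l. *)
Variable n : 'I_4 -> 'rV[R]_3.

Definition M_face l (v : 'rV[R]_3 -> 'rV[R]_3) : 'rV[R]_3 :=
  triangle_vint (x (face_vtx l 0)) (x (face_vtx l 1)) (x (face_vtx l 2))
    (fun y => cross (curl v y) (n l)).

(* The subscripts 1, 2 of the basis functions phi_{F_l,1}, phi_{F_l,2} are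
   k = 0, 1 here. *)
Definition phi_face l (k : 'I_3) y : 'rV[R]_3 :=
  let g := grad_lambda (face_vtx l k) in
  (4^-1 * (8 * lambda l y - 3)) *: cross (y - barycenter) (cross (n l) g)
  + (4^-1 * dot (x l - barycenter) (n l)) *: g
  + 16^-1 *: n l.

Definition coef1 i j l : R :=
  let g1 := grad_lambda (face_vtx l 0) in
  let g2 := grad_lambda (face_vtx l 1) in
  (dot (cross g1 g2) (n l))^-1 *
  dot (cross (grad_lambda j) (grad_lambda i)) (cross (cross (n l) g2) (n l)).

Definition coef2 i j l : R :=
  let g1 := grad_lambda (face_vtx l 0) in
  let g2 := grad_lambda (face_vtx l 1) in
  (dot (cross g2 g1) (n l))^-1 *
  dot (cross (grad_lambda j) (grad_lambda i)) (cross (cross (n l) g1) (n l)).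

Definition phi_edge i j y : 'rV[R]_3 :=
  lambda i y *: grad_lambda j - lambda j y *: grad_lambda i
  + \sum_l (coef1 i j l *: phi_face l 0 y + coef2 i j l *: phi_face l 1 y).

End Tetrahedron.

Section BarycentricFacts.
Variables (R : realType) (x : 'I_4 -> 'rV[R]_3).

Lemma bary_mx_unit : nondegenerate x -> bary_mx x \in unitmx.
Proof.
move=> hx; rewrite -row_free_unit -kermx_eq0; apply/eqP/row_matrixP => r.
have: row r (kermx (bary_mx x)) *m bary_mx x = 0.
  by rewrite -row_mul mulmx_ker row0.
move: (row r _) => c hc; rewrite row0.
have hsum : \sum_l c 0 l *: row_mx (x l) (1 : 'rV[R]_1) = 0.
  rewrite -[RHS]hc mulmx_sum_row; apply: eq_bigr => l _.
  by rewrite rowK.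
have h1 : \sum_l c 0 l = 0.
  have := congr1 (fun u : 'rV[R]_(3 + 1) => u 0 (rshift 3 ord0)) hsum.
  rewrite summxE mxE => h; rewrite -[RHS]h; apply: eq_bigr => l _.
  by rewrite mxE row_mxEr mxE mulr1.
have h2 : \sum_l c 0 l *: x l = 0.
  apply/rowP => k; have := congr1
    (fun u : 'rV[R]_(3 + 1) => u 0 (lshift 1 k)) hsum.
  rewrite !summxE !mxE => h; rewrite -[RHS]h; apply: eq_bigr => l _.
  by rewrite !mxE (unsplitK (inl k)).
have h3 : \row_k c 0 (lift ord0 k) = 0 :> 'rV[R]_3.
  apply: (row_free_inj hx); rewrite mul0mx mulmx_sum_row.
  transitivity (\sum_l c 0 l *: (x l - x ord0)).
    rewrite [RHS]big_ord_recl subrr scaler0 add0r.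
    by apply: eq_bigr => k _; rewrite rowK mxE.
  under eq_bigr do rewrite scalerBr.
  by rewrite big_split /= h2 add0r sumrN -scaler_suml h1 scale0r oppr0.
have h4 k : c 0 (lift ord0 k) = 0.
  by have := congr1 (fun u : 'rV[R]_3 => u 0 k) h3; rewrite !mxE.
apply/rowP => l; rewrite mxE; case: (unliftP ord0 l) => [k ->|->]; first exact: h4.
by move: h1; rewrite big_ord_recl big1 ?addr0 // => k _; exact: h4.
Qed.

Lemma lambdaP (y : 'rV[R]_3) : nondegenerate x ->
  \sum_l lambda x l y *: x l = y /\ \sum_l lambda x l y = 1.
Proof.
move=> /bary_mx_unit hu.
have hsum : \sum_l lambda x l y *: row_mx (x l) (1 : 'rV[R]_1)
          = row_mx y (1 : 'rV[R]_1).
  rewrite -[RHS](mulmxKV hu) mulmx_sum_row; apply: eq_bigr => l _.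
  by rewrite rowK.
split.
  apply/rowP => k; have := congr1
    (fun u : 'rV[R]_(3 + 1) => u 0 (lshift 1 k)) hsum.
  rewrite summxE row_mxEl => <-; rewrite summxE; apply: eq_bigr => l _.
  by rewrite !mxE (unsplitK (inl k)).
have := congr1 (fun u : 'rV[R]_(3 + 1) => u 0 (rshift 3 ord0)) hsum.
rewrite summxE row_mxEr mxE => h; rewrite -[RHS]h; apply: eq_bigr => l _.
by rewrite mxE row_mxEr mxE mulr1.
Qed.

Lemma grad_lambdaE (l : 'I_4) (y : 'rV[R]_3) :
  grad (lambda x l) y = grad_lambda x l.
Proof.
apply/rowP => k; rewrite !mxE /pderiv /derive.
suff H z : (fun h : R => h^-1 *: ((lambda x l \o shift z)
      (h *: delta_mx 0 k) - lambda x l z)) =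
    (fun h : R => h^-1 *:
      (h *: ((row_mx (delta_mx 0 k : 'rV[R]_3) (0 : 'rV[R]_1)
        *m invmx (bary_mx x)) 0 l : R^o))).
  by rewrite !H.
apply/funext => h; congr (_ *: _); rewrite /lambda /=.
have -> : row_mx (h *: delta_mx 0 k + z) (1 : 'rV[R]_1) =
  h *: row_mx (delta_mx 0 k) 0 + row_mx z 1.
  by rewrite scale_row_mx add_row_mx scaler0 add0r.
by rewrite mulmxDl -scalemxAl !mxE addrK.
Qed.

End BarycentricFacts.

(* Main.v *)
Require Import Defs.
From mathcomp Require Import measurable_realfun ring lra.

Import Order.TTheory GRing.Theory Num.Theory.
Local Open Scope ring_scope.

(** Write [g_l] for the gradient of [lambda_l].  Each outward normal is a
    multiple [n_l = h_l g_l] of a gradient, the scalar [h_l] being minus the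
    distance from [x_l] to its face.  The vector triple product formula then
    turns the face function attached to [F_l] and to a vertex [m] of [F_l]
    into a combination of [g_l] and [g_m] whose coefficients are quadratic
    polynomials in [lambda_l] and [lambda_m] ([phi_faceE]), and everything
    reduces to two computations.

    Edges.  Along an edge the quadratic terms of the tangential component of
    a face function cancel, so this component is affine in the arc parameter
    and its mean is its value at the midpoint.  The constants 1/4 and 1/16
    make this value vanish for every face function ([edge_mean_phi_face]).
    The tangential component of the Whitney part
    [lambda_i g_j - lambda_j g_i] is constant along an edge, equal to 1 on the
    edge [ij] and to 0 on the others ([edge_mean_phi_edge]).

    Faces.  The curl of a face function is [(2 - 6 lambda_l) n_l x g_m]
    ([curl_phi_face]), and the curl of the Whitney part is [2 g_i x g_j], so
    the curl of [phi_edge] is affine and its integral over a face is the area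
    times the mean of its three vertex values.  On a face other than
    [F_l] the mean of [lambda_l] is 1/3, so the factor [2 - 6 lambda_l]
    averages to 0; on [F_l] this factor is 2.  On [F_l] only the functions
    attached to [F_l] therefore matter, and what is left to check is

      [(g_j x g_i) x n_l = c_1 P g_{l_1} + c_2 P g_{l_2}],

    where [P] is the orthogonal projection onto the plane of [F_l].  The
    coefficients [c_1], [c_2] of the theorem are exactly the coordinates of
    the left-hand side in that basis of the plane
    ([tangential_decomposition], [cross_cross_grad_normal]). *)

Set Implicit Arguments.
Unset Strict Implicit.
Unset Printing Implicit Defensive.

(** * Integrals over an interval and over the reference triangle *)

Section Integrals.
Local Open Scope classical_set_scope.
Local Open Scope ring_scope.
Variable R : realType.
Local Notation mu := (@lebesgue_measure R).

Lemma integral_quadratic (c0 c1 c2 b : R) : 0 <= b ->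
  (\int[mu]_(s in `[0%R, b]) (c0 + c1 * s + c2 * s ^+ 2)%:E)%E =
  (c0 * b + c1 * b ^+ 2 / 2 + c2 * b ^+ 3 / 3)%:E.
Proof.
rewrite le_eqVlt => /predU1P[<-|b0].
  by rewrite set_itv1 integral_set1; congr (_%:E); ring.
pose p : {poly R} := Poly [:: c0; c1; c2].
pose F : {poly R} := Poly [:: 0; c0; c1 / 2; c2 / 3].
have FE s : F.[s] = c0 * s + c1 * s ^+ 2 / 2 + c2 * s ^+ 3 / 3.
  by rewrite horner_Poly /=; ring.
have pE s : p.[s] = c0 + c1 * s + c2 * s ^+ 2.
  by rewrite horner_Poly /=; ring.
have dF : F^`() = p.
  apply/polyP => k; rewrite coef_deriv !coef_Poly.
  by case: k => [|[|[|k]]] //=; rewrite ?nth_nil ?mul0rn // -mulr_natr; field.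
under eq_integral do rewrite -pE.
rewrite (@continuous_FTC2 _ _ (horner F)) //.
- by rewrite -EFinB !FE; congr (_%:E); ring.
- by apply: continuous_subspaceT => s; exact: continuous_horner.
- have hc : continuous (horner F) by move=> s; exact: continuous_horner.
  split.
  + move=> s _; exact: derivable_horner.
  + by apply: cvg_at_right_filter; exact: hc.
  + by apply: cvg_at_left_filter; exact: hc.
- by move=> s _; rewrite derive1E derive_val dF.
Qed.

Lemma measurable_ref_triangle : measurable (@ref_triangle R).
Proof.
rewrite (_ : @ref_triangle R = [set p | 0 <= p.1] `&` [set p | 0 <= p.2]
    `&` [set p | p.1 + p.2 <= 1]); last first.
  by apply/seteqP; split => p; rewrite /ref_triangle /=; tauto.
rewrite -[X in measurable (X `&` _ `&` _)]setTI.
rewrite -[X in measurable (_ `&` X `&` _)]setTI.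
rewrite -[X in measurable (_ `&` X)]setTI.
apply: measurableI; first apply: measurableI.
- by apply: (measurable_fun_le measurableT (f := cst 0) (g := fst)).
- by apply: (measurable_fun_le measurableT (f := cst 0) (g := snd)).
- apply: (measurable_fun_le measurableT (g := cst 1)) => //.
  by apply: measurable_funD; [exact: measurable_fst|exact: measurable_snd].
Qed.

(** Fubini: the slice of the triangle above [s] is the interval [0, 1 - s], so
    both iterated integrals are integrals of quadratic polynomials. *)
Lemma Rintegral_ref_triangle (c0 c1 c2 : R) :
  \int[(mu \x mu)%E]_(p in @ref_triangle R) (c0 + c1 * p.1 + c2 * p.2) =
  c0 / 2 + c1 / 6 + c2 / 6.
Proof.
have mT := measurable_ref_triangle.
pose f (p : R * R) : R := c0 + c1 * p.1 + c2 * p.2.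
have mf : measurable_fun setT f.
  apply: measurable_funD; first apply: measurable_funD => //.
    exact: measurable_funM (measurable_cst c1) measurable_fst.
  exact: measurable_funM (measurable_cst c2) measurable_snd.
(* An affine function is bounded on the triangle, which has finite measure. *)
have fT : (mu \x mu)%E.-integrable (@ref_triangle R) (EFin \o f).
  apply: measurable_bounded_integrable => //.
  - apply: (@le_lt_trans _ _ ((mu \x mu)%E (`[0%R, 1%R] `*` `[0%R, 1%R]))).
      apply: le_measure; rewrite ?inE //; first exact: measurableX.
      move=> [s t] [/= s0 [t0 st]]; rewrite !in_itv /=; lra.
    rewrite product_measure1E //= lebesgue_measure_itv /= lte_fin ltr01.
    by rewrite -EFinB -EFinM ltry.
  - exact: measurable_funS mf.
  - exists (`|c0| + `|c1| + `|c2|); split; first exact: num_real.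
    move=> M /ltW hM p [/= p0 [q0 pq]]; apply: le_trans hM.
    rewrite /f; apply: (le_trans (ler_normD _ _)); apply: lerD.
      apply: (le_trans (ler_normD _ _)); rewrite lerD2l normrM (ger0_norm p0).
      by rewrite ler_piMr //; lra.
    by rewrite normrM (ger0_norm q0) ler_piMr //; lra.
rewrite /Rintegral integral_mkcond.
have fT' :
    (mu \x mu)%E.-integrable setT ((EFin \o f) \_ @ref_triangle R).
  apply: (integrable_mkcond _ _).1 => //.
rewrite -[X in fine X](integral12_prod_meas1 fT') /fubini_F.
transitivity (fine (\int[mu]_(s in `[0%R, 1%R])
  (c0 + c2 / 2 + (c1 - c0 - c2) * s + (c2 / 2 - c1) * s ^+ 2)%:E)%E);
  last first.
  by rewrite integral_quadratic //=; field.
(* The inner integral at s is (c0 + c1 s) (1 - s) + c2 (1 - s)^2 / 2. *)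
congr fine; rewrite [RHS]integral_mkcond; apply: eq_integral => s _.
rewrite /patch; case: ifPn => [|hs].
  rewrite inE /= in_itv /= => /andP[s0 s1].
  transitivity (\int[mu]_(t in `[0%R, (1 - s)%R])
    (c0 + c1 * s + c2 * t + 0 * t ^+ 2)%:E)%E.
    rewrite [RHS]integral_mkcond; apply: eq_integral => t _; rewrite /patch.
    have -> : ((s, t) \in @ref_triangle R) = (t \in `[0, 1 - s]%classic).
      by apply/idP/idP; rewrite !inE /ref_triangle /= in_itv /=; lra.
    by case: ifP => // _; congr (_%:E); rewrite /f /=; ring.
  by rewrite integral_quadratic ?subr_ge0 //; congr (_%:E); field.
rewrite integral0_eq // => t _; case: ifPn => // ht; case/negP: hs.
by move: ht; rewrite !inE /ref_triangle /= in_itv /=; lra.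
Qed.

End Integrals.

(** * Vector algebra in dimension three *)

Section VectorAlgebra.
Variable R : realType.
Implicit Types u v w a b c n : 'rV[R]_3.

Lemma forall_ord3 (P : 'I_3 -> Prop) : P 0 -> P 1 -> P 2 -> forall k, P k.
Proof.
move=> P0 P1 P2 [[|[|[|//]]] hk].
- by rewrite (_ : Ordinal hk = 0) //; exact: val_inj.
- by rewrite (_ : Ordinal hk = 1) //; exact: val_inj.
- by rewrite (_ : Ordinal hk = 2) //; exact: val_inj.
Qed.

Lemma row3P u v : u 0 0 = v 0 0 -> u 0 1 = v 0 1 -> u 0 2 = v 0 2 -> u = v.
Proof. by move=> ? ? ?; apply/rowP; exact: forall_ord3. Qed.

Lemma sum3E (V : nmodType) (f : 'I_3 -> V) : \sum_k f k = f 0 + f 1 + f 2.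
Proof.
rewrite !big_ord_recl big_ord0 addr0 addrA.
by congr (_ + f _ + f _); exact: val_inj.
Qed.

Lemma dotE u v : dot u v = u 0 0 * v 0 0 + u 0 1 * v 0 1 + u 0 2 * v 0 2.
Proof. exact: sum3E. Qed.

Lemma crossE u v :
  (cross u v 0 0 = u 0 1 * v 0 2 - u 0 2 * v 0 1) *
  (cross u v 0 1 = u 0 2 * v 0 0 - u 0 0 * v 0 2) *
  (cross u v 0 2 = u 0 0 * v 0 1 - u 0 1 * v 0 0).
Proof. by rewrite !mxE. Qed.

Fact mxDE u v k : (u + v) 0 k = u 0 k + v 0 k. Proof. exact: mxE. Qed.
Fact mxNE u k : (- u) 0 k = - u 0 k. Proof. exact: mxE. Qed.
Fact mxZE (s : R) u k : (s *: u) 0 k = s * u 0 k. Proof. exact: mxE. Qed.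
Fact mx0E k : (0 : 'rV[R]_3) 0 k = 0. Proof. exact: mxE. Qed.
Definition coordE := (dotE, crossE, mxDE, mxNE, mxZE, mx0E).

Lemma dotC u v : dot u v = dot v u.
Proof. by rewrite !coordE; ring. Qed.
Lemma dotDl u v w : dot (u + v) w = dot u w + dot v w.
Proof. by rewrite !coordE; ring. Qed.
Lemma dotZl (s : R) u v : dot (s *: u) v = s * dot u v.
Proof. by rewrite !coordE; ring. Qed.
Lemma dotBl u v w : dot (u - v) w = dot u w - dot v w.
Proof. by rewrite !coordE; ring. Qed.
Lemma dotBr u v w : dot u (v - w) = dot u v - dot u w.
Proof. by rewrite !coordE; ring. Qed.
Lemma dotZr (s : R) u v : dot u (s *: v) = s * dot u v.
Proof. by rewrite !coordE; ring. Qed.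
Lemma dot0l u : dot 0 u = 0.
Proof. by rewrite !coordE; ring. Qed.
Lemma dot0r u : dot u 0 = 0.
Proof. by rewrite dotC dot0l. Qed.
Lemma dotDr u v w : dot u (v + w) = dot u v + dot u w.
Proof. by rewrite !coordE; ring. Qed.
Lemma dot_sumr (I : finType) u (f : I -> 'rV[R]_3) :
  dot u (\sum_l f l) = \sum_l dot u (f l).
Proof. exact: (big_morph (dot u) (dotDr u) (dot0r u)). Qed.

Lemma dot_eq0 u : (dot u u == 0) = (u == 0).
Proof.
apply/eqP/eqP => [h|->]; last exact: dot0l.
have hk k : u 0 k = 0.
  apply/eqP; rewrite -sqrf_eq0 eq_le sqr_ge0 andbT -h.
  rewrite /dot (bigD1 k) //= -expr2 lerDl.
  by apply: sumr_ge0 => m _; rewrite -expr2 sqr_ge0.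
by apply: row3P; rewrite hk mxE.
Qed.

Lemma enorm_eq0 u : (enorm u == 0) = (u == 0).
Proof.
rewrite /enorm sqrtr_eq0 -dot_eq0 eq_le [0 <= _]sumr_ge0 ?andbT // => k _.
by rewrite -expr2 sqr_ge0.
Qed.

Lemma crossDl u v w : cross (u + v) w = cross u w + cross v w.
Proof. by apply: row3P; rewrite !coordE; ring. Qed.
Lemma crossZl (s : R) u v : cross (s *: u) v = s *: cross u v.
Proof. by apply: row3P; rewrite !coordE; ring. Qed.
Lemma crossZr (s : R) u v : cross u (s *: v) = s *: cross u v.
Proof. by apply: row3P; rewrite !coordE; ring. Qed.
Lemma crossC u v : cross u v = - cross v u.
Proof. by apply: row3P; rewrite !coordE; ring. Qed.

Lemma cross_cross u v w : cross u (cross v w) = dot u w *: v - dot u v *: w.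
Proof. by apply: row3P; rewrite !coordE; ring. Qed.

(** The left factors [(n x a) x n] and [(n x b) x n] are the projections [P a],
    [P b] onto the plane orthogonal to [n].  The right-hand side is the triple
    product [w x (P a x P b)], and [P a x P b] is normal to the plane, equal to
    [dot (cross a b) n *: n].  When the scalar [dot (cross a b) n] is nonzero
    this gives the coordinates of the tangential vector [w x n] in the basis
    [P a], [P b]. *)
Lemma tangential_decomposition n a b w : dot n n = 1 ->
  dot (cross a b) n *: cross w n =
  dot w (cross (cross n b) n) *: cross (cross n a) n
  - dot w (cross (cross n a) n) *: cross (cross n b) n.
Proof.
move=> n1; rewrite -cross_cross.
(* For n of any length the projections acquire a factor |n|^2 each; this form
   is homogeneous, hence an identity of polynomials in the coordinates. *)
have -> : cross (cross (cross n a) n) (cross (cross n b) n)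
   = (dot n n * dot (cross a b) n) *: n.
  by apply: row3P; rewrite !coordE; ring.
by rewrite n1 mul1r crossZr.
Qed.

(** Multiplicativity of the 3 x 3 determinant: the triple product is the
    determinant of its three rows, and the right-hand side is the determinant
    of the Gram matrix of [a], [b], [c] against [u], [v], [w]. *)
Lemma triple_mul a b c u v w :
  dot (cross a b) c * dot (cross u v) w =
    dot a u * (dot b v * dot c w - dot b w * dot c v)
  - dot a v * (dot b u * dot c w - dot b w * dot c u)
  + dot a w * (dot b u * dot c v - dot b v * dot c u).
Proof. by rewrite !coordE; ring. Qed.

End VectorAlgebra.

(** * Gradients and curls of polynomial fields *)

Section Curl.
Local Open Scope classical_set_scope.
Local Open Scope ring_scope.
Variable R : realType.
Implicit Types (f : 'rV[R]_3 -> R) (y v G c : 'rV[R]_3).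

Lemma is_derive_quadratic f y v (a b : R) :
  (forall h, f (y + h *: v) = f y + h * a + h ^+ 2 * b) -> is_derive y v f a.
Proof.
move=> hf.
have cv : (fun h : R => h^-1 *: ((f \o shift y) (h *: v) - f y)) @ 0^'
    --> (a : R^o).
  have : (fun h : R => a + h * b) @ 0^' --> a + 0 * b.
    apply: cvg_within_filter; apply: cvgD; first exact: cvg_cst.
    by apply: cvgM; [exact: cvg_id|exact: cvg_cst].
  rewrite mul0r addr0; apply: cvg_trans; apply: near_eq_cvg.
  near=> h; rewrite /= [h *: v + y]addrC hf.
  have h0 : h != 0 by near: h; exact: nbhs_dnbhs_neq.
  by rewrite /GRing.scale /=; field.
apply: DeriveDef; first by apply/cvg_ex; exists a.
exact: cvg_lim cv.
Unshelve. all: by end_near.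
Qed.

(** Derivability is part of the predicate, which is what the rules for sums and
    multiples need. *)
Definition has_grad f y G := forall v, is_derive y v f (dot G v).

Lemma has_grad_quadratic f y G (b : 'rV[R]_3 -> R) :
  (forall v h, f (y + h *: v) = f y + h * dot G v + h ^+ 2 * b v) ->
  has_grad f y G.
Proof. by move=> hf v; apply: is_derive_quadratic => h; exact: hf. Qed.

Lemma gradE f y G : has_grad f y G -> grad f y = G.
Proof.
move=> hG; apply/rowP => k; rewrite mxE /pderiv.
have ? := hG (delta_mx 0 k); rewrite derive_val /dot (bigD1 k) //= big1.
  by rewrite !mxE !eqxx mulr1 addr0.
by move=> m mk; rewrite !mxE (negPf mk) andbF mulr0.
Qed.

(** The witness [J] is the Jacobian matrix: [J m k] is the derivative of the
    component [m] in the direction [k]. *)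
Definition is_curl (w : 'rV[R]_3 -> 'rV[R]_3) y c := exists J : 'M[R]_3,
  (forall m, has_grad (fun z => w z 0 m) y (row m J)) /\
  c = vec3 (J 2 1 - J 1 2) (J 0 2 - J 2 0) (J 1 0 - J 0 1).

Lemma curlE w y c : is_curl w y c -> curl w y = c.
Proof.
move=> [J [hJ ->]]; rewrite /curl.
have E k m : pderiv k (fun z => w z 0 m) y = J m k.
  by have := congr1 (fun u : 'rV_3 => u 0 k) (gradE (hJ m)); rewrite !mxE.
by rewrite !E.
Qed.

Lemma is_curl_scale f y G c : has_grad f y G ->
  is_curl (fun z => f z *: c) y (cross G c).
Proof.
move=> hG; exists (\matrix_(m, k) (c 0 m * G 0 k)); split=> [m v|].
  rewrite (_ : (fun z => _) = c 0 m \*: f); last first.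
    by apply/funext => z; rewrite mxE mulrC.
  have ? := hG v; apply: is_derive_eq.
  rewrite /GRing.scale /= /dot mulr_sumr; apply: eq_bigr => k _.
  by rewrite !mxE mulrA.
by rewrite !mxE /cross; congr vec3; ring.
Qed.

Lemma is_curlD w1 w2 y c1 c2 : is_curl w1 y c1 -> is_curl w2 y c2 ->
  is_curl (fun z => w1 z + w2 z) y (c1 + c2).
Proof.
move=> [J1 [h1 ->]] [J2 [h2 ->]]; exists (J1 + J2); split=> [m v|].
  rewrite (_ : (fun z => _) = (fun z => w1 z 0 m) + (fun z => w2 z 0 m)).
    2: by apply/funext => z; rewrite mxE.
  have ? := h1 m v; have ? := h2 m v; apply: is_derive_eq.
  by rewrite linearD dotDl.
by apply: row3P; rewrite !mxE /=; ring.
Qed.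

Lemma is_curl0 y : is_curl (fun=> 0) y 0.
Proof.
exists 0; split=> [m v|]; last by apply: row3P; rewrite !mxE /=; ring.
rewrite linear0 dot0l (_ : (fun z => _) = cst 0); first exact: is_derive_cst.
by apply/funext => z; rewrite mxE.
Qed.

Lemma is_curlZ w y (s : R) c : is_curl w y c ->
  is_curl (fun z => s *: w z) y (s *: c).
Proof.
move=> [J [h ->]]; exists (s *: J); split=> [m v|].
  rewrite (_ : (fun z => _) = s \*: (fun z => w z 0 m)); last first.
    by apply/funext => z; rewrite mxE.
  have ? := h m v; apply: is_derive_eq.
  by rewrite linearZ /= dotZl.
by apply: row3P; rewrite !mxE /=; ring.
Qed.

Lemma is_curl_sum (I : finType) (w : I -> 'rV[R]_3 -> 'rV[R]_3) y
    (c : I -> 'rV[R]_3) : (forall l, is_curl (w l) y (c l)) ->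
  is_curl (fun z => \sum_l w l z) y (\sum_l c l).
Proof.
move=> h; rewrite (_ : (fun z => _) = \sum_l w l); last first.
  by apply/funext => z; rewrite fct_sumE.
elim/big_ind2: _ => [|? ? ? ? h1 h2|l _]; [exact: is_curl0| |exact: h].
exact: is_curlD h1 h2.
Qed.

End Curl.

(** * Edge and face functionals on affine data *)

Section Functionals.
Variable R : realType.

(** An affine function has integral equal to the area of the triangle times
    the mean of its three vertex values; the weight is 1/6 and not 1/3 because
    the norm of the cross product is twice the area. *)
Lemma triangle_int_affine (a b c : 'rV[R]_3) (f : 'rV[R]_3 -> R) :
  (forall s t, f (a + s *: (b - a) + t *: (c - a)) =
     (1 - s - t) * f a + s * f b + t * f c) ->
  triangle_int a b c f =
    enorm (cross (b - a) (c - a)) * (6^-1 * (f a + f b + f c)).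
Proof.
move=> hf; rewrite /triangle_int; congr (_ * _).
under eq_Rintegral => p _.
  rewrite hf (_ : _ + _ = f a + (f b - f a) * p.1 + (f c - f a) * p.2).
    over.
  by ring.
by rewrite Rintegral_ref_triangle; field.
Qed.

Variable x : 'I_4 -> 'rV[R]_3.

(** The tangential component of [v] is affine along the edge from [x p] to
    [x q], with value [m] at the midpoint: then [m] is also its mean, and this
    condition on [v], [m] is linear. *)
Definition edge_mean (p q : 'I_4) (v : 'rV[R]_3 -> 'rV[R]_3) (m : R) :=
  exists c : R, forall s : R,
    dot (v (x p + s *: (x q - x p))) (x q - x p) = m + c * (s - 2^-1).

Lemma M_edgeE p q v m : x p != x q -> edge_mean p q v m -> M_edge x p q v = m.
Proof.
move=> pq [c hc]; rewrite /M_edge /segment_int mulKf; last first.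
  by rewrite enorm_eq0 subr_eq0 eq_sym.
under eq_Rintegral => s _.
  rewrite hc (_ : _ + _ = (m - c / 2) + c * s + 0 * s ^+ 2); last by field.
  over.
by rewrite /Rintegral integral_quadratic //=; field.
Qed.

Lemma edge_meanD p q v1 v2 m1 m2 : edge_mean p q v1 m1 -> edge_mean p q v2 m2 ->
  edge_mean p q (fun y => v1 y + v2 y) (m1 + m2).
Proof.
by move=> [c1 h1] [c2 h2]; exists (c1 + c2) => s; rewrite dotDl h1 h2; ring.
Qed.

Lemma edge_meanZ p q (k : R) v m : edge_mean p q v m ->
  edge_mean p q (fun y => k *: v y) (k * m).
Proof. by move=> [c h]; exists (k * c) => s; rewrite dotZl h; ring. Qed.

Lemma edge_mean_sum (I : finType) p q (v : I -> 'rV[R]_3 -> 'rV[R]_3)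
    (m : I -> R) : (forall l, edge_mean p q (v l) (m l)) ->
  edge_mean p q (fun y => \sum_l v l y) (\sum_l m l).
Proof.
move=> h; rewrite (_ : (fun y => _) = \sum_l v l); last first.
  by apply/funext => z; rewrite fct_sumE.
elim/big_ind2: _ => [|? ? ? ? h1 h2|l _]; [|exact: edge_meanD|exact: h].
by exists 0 => s; rewrite dot0l; ring.
Qed.

End Functionals.

(** * Barycentric coordinates, face functions and edge functions *)

Section Tetrahedron.
Variables (R : realType) (x : 'I_4 -> 'rV[R]_3).
Local Notation g := (grad_lambda x).
Local Notation lam := (lambda x).

(** A barycentric coordinate is the restriction of a linear form to the affine
    hyperplane of vectors [(y, 1)]; the gradient is read off on the vectors
    [(delta_k, 0)]. *)
Lemma lambda_affine l y v : lam l (y + v) = lam l y + dot (g l) v.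
Proof.
pose L (u : 'rV[R]_3) := (row_mx u (0 : 'rV[R]_1) *m invmx (bary_mx x)) 0 l.
have lamD z u : lam l (z + u) = lam l z + L u.
  rewrite /lambda /L -[X in row_mx (z + u) X]addr0 -add_row_mx.
  by rewrite mulmxDl mxE.
have LZ (h : R) u : L (h *: u) = h * L u.
  rewrite /L -[X in row_mx (h *: u) X](scaler0 _ h) -scale_row_mx.
  by rewrite -scalemxAl mxE.
have LD u w : L (u + w) = L u + L w.
  by rewrite /L -[X in row_mx (u + w) X]addr0 -add_row_mx mulmxDl mxE.
have gk k : g l 0 k = L (delta_mx 0 k).
  rewrite mxE /pderiv.
  have h : is_derive (barycenter x) (delta_mx 0 k) (lam l) (L (delta_mx 0 k)).
    apply: (@is_derive_quadratic _ _ _ _ _ 0) => h.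
    by rewrite lamD LZ; ring.
  by rewrite derive_val.
rewrite lamD; congr (_ + _).
have L0 : L 0 = 0 by rewrite -(scale0r (0 : 'rV[R]_3)) LZ mul0r.
rewrite {1}(row_sum_delta v) (big_morph L LD L0) /dot.
by apply: eq_bigr => k _; rewrite LZ gk mulrC.
Qed.

Lemma dot_grad_lambda l y z : dot (g l) (y - z) = lam l y - lam l z.
Proof.
by have := lambda_affine l z (y - z); rewrite (addrC z) subrK => ->; ring.
Qed.

Lemma has_grad_lambda l y : has_grad (lam l) y (g l).
Proof.
move=> v; apply: (@is_derive_quadratic _ _ _ _ _ 0) => h.
by rewrite lambda_affine dotZr; ring.
Qed.

Hypothesis hK : nondegenerate x.

Lemma lambda_vertex l m : lam l (x m) = (l == m)%:R.
Proof.
have -> : lam l (x m) = (bary_mx x *m invmx (bary_mx x)) m l.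
  rewrite /lambda (_ : row_mx (x m) 1 = row m (bary_mx x)).
    by rewrite -row_mul mxE.
  by rewrite rowK.
by rewrite mulmxV ?bary_mx_unit // mxE eq_sym.
Qed.

Lemma sum_lambda_vertex l : \sum_m lam l (x m) = 1.
Proof.
under eq_bigr do rewrite lambda_vertex.
by rewrite (bigD1 l) //= eqxx big1 ?addr0 // => m; rewrite eq_sym => /negPf->.
Qed.

Lemma dot_grad_edge l p q : dot (g l) (x p - x q) = (l == p)%:R - (l == q)%:R.
Proof. by rewrite dot_grad_lambda !lambda_vertex. Qed.

Lemma vertex_inj : injective x.
Proof.
move=> p q hpq; apply/eqP; have := lambda_vertex p p.
rewrite {1}hpq lambda_vertex eqxx.
by case: eqP => // _ /eqP; rewrite eq_sym oner_eq0.
Qed.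

Lemma lambda_barycenter l : lam l (barycenter x) = 4^-1.
Proof.
have h m : lam l (x m) = lam l (barycenter x) + dot (g l) (x m - barycenter x).
  by rewrite dot_grad_lambda; ring.
have h0 : \sum_m (x m - barycenter x) = 0.
  rewrite sumrB sumr_const card_ord /barycenter -scaler_nat scalerA.
  by rewrite mulfV ?pnatr_eq0 // scale1r subrr.
have := sum_lambda_vertex l.
under eq_bigr do rewrite h.
rewrite big_split /= -dot_sumr h0 dot0r sumr_const card_ord => h4.
by rewrite addr0 -mulr_natr in h4; lra.
Qed.

(** The edge vectors span the space: [u] itself is a combination of them, with
    the barycentric coordinates of [x ord0 + u] as coefficients. *)
Lemma edge_ext u : (forall p q, dot u (x p - x q) = 0) -> u = 0.
Proof.
move=> hu; apply/eqP; rewrite -dot_eq0; apply/eqP.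
have [hy h1] := lambdaP (x ord0 + u) hK.
have -> : dot u u = dot u (\sum_l lam l (x ord0 + u) *: (x l - x ord0)).
  congr dot; under eq_bigr do rewrite scalerBr.
  by rewrite big_split /= hy sumrN -scaler_suml h1 scale1r addrAC subrr add0r.
by rewrite dot_sumr big1 // => l _; rewrite dotZr hu mulr0.
Qed.

(** Against the three edges that leave the remaining vertex [r], the gradients
    [g p], [g q], [g l] form a dual basis, so their Gram determinant is 1. *)
Lemma triple_neq0 l p q : p != q -> p != l -> q != l ->
  dot (cross (g p) (g q)) (g l) != 0.
Proof.
move=> pq pl ql.
have /allPn[r _] : ~~ all (mem [:: p; q; l]) (enum 'I_4).
  by apply/negP => /allP/(uniq_leq_size (enum_uniq _)); rewrite size_enum_ord.
rewrite /= !inE !negb_or => /and3P[rp rq rl].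
have := triple_mul (g p) (g q) (g l) (x p - x r) (x q - x r) (x l - x r).
rewrite !dot_grad_edge !eqxx (eq_sym q p) (eq_sym l p) (eq_sym l q).
rewrite ![_ == r]eq_sym (negPf rp) (negPf rq) (negPf rl).
rewrite (negPf pq) (negPf pl) (negPf ql) => h.
by apply/eqP => h0; move: h; rewrite h0 /=; lra.
Qed.

Variable n : 'I_4 -> 'rV[R]_3.
Hypothesis hn : forall l : 'I_4, outward_unit_normal x l (n l).

Lemma face_vtx_neq l k : (face_vtx l k == l) = false.
Proof. by rewrite eq_sym; apply/negbTE; exact: neq_lift. Qed.

(** The signed height of [x l] over its face along the outward normal, hence a
    negative number. *)
Definition height l := dot (n l) (x l - x (face_vtx l 0)).

(** Both sides are orthogonal to the face, and they agree on the edges that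
    leave [x l]; edges determine a vector. *)
Lemma normal_grad l : n l = height l *: g l.
Proof.
apply/eqP; rewrite -subr_eq0; apply/eqP/edge_ext => p q.
rewrite dotBl dotZl dot_grad_edge.
have [_ h0 _] := hn l.
have hl r : r != l -> dot (n l) (x l - x r) = height l.
  move=> rl; apply/eqP; rewrite -subr_eq0 -dotBr opprB addrC addrA subrK h0 //.
  by rewrite face_vtx_neq.
have [<-|pl] := eqVneq l p; have [<-|ql] := eqVneq l q.
- by rewrite !subrr dot0r mulr0 subr0.
- by rewrite hl 1?eq_sym //=; ring.
- by rewrite -[x p - x l]opprB -scaleN1r dotZr hl 1?eq_sym //=; ring.
- by rewrite h0 1?eq_sym //=; ring.
Qed.

Lemma height_neq0 l : height l != 0.
Proof.
apply/eqP => h; have [n1 _ _] := hn l; move: n1.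
rewrite normal_grad h scale0r => /eqP.
by rewrite /enorm dot0l sqrtr0 eq_sym oner_eq0.
Qed.

Lemma normal_unit l : dot (n l) (n l) = 1.
Proof.
have [n1 _ _] := hn l; rewrite -(@sqr_sqrtr _ (dot _ _)) ?n1 ?expr1n //.
  by rewrite -/(enorm _) n1 expr1n.
by apply: sumr_ge0 => k _; rewrite -expr2 sqr_ge0.
Qed.

Lemma dot_normal l y z : dot (n l) (y - z) = height l * (lam l y - lam l z).
Proof. by rewrite normal_grad dotZl dot_grad_lambda. Qed.

(** The triple product formula expands the cross products of the face function,
    and dot products with [n l] become multiples of differences of [lambda_l].
    Here [dot (x l - barycenter) (n l)] is 3/4 of the height. *)
Lemma phi_faceE l k y (m := face_vtx l k) :
  phi_face x n l k y =
  (height l / 4 * (8 * lam l y - 3) * (lam m y - 4^-1) + height l / 16) *: g l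
  + (height l * 3 / 16 - height l / 4 * (8 * lam l y - 3) * (lam l y - 4^-1))
    *: g m.
Proof.
rewrite /phi_face -/m cross_cross.
rewrite [dot _ (g m)]dotC ![dot _ (n l)]dotC !dot_normal dot_grad_lambda.
rewrite !lambda_barycenter lambda_vertex eqxx normal_grad.
by rewrite /=; apply: row3P; rewrite !coordE; field.
Qed.

(** In [phi_faceE] the coefficient of [g l] contributes only through the [g m]
    part of its gradient, and the gradient of the coefficient of [g m] is a
    multiple of [g l].  Both products are thus multiples of [g l x g m], with
    total factor
    [- height l / 4 * ((8 lambda_l - 3) + (16 lambda_l - 5))
     = height l * (2 - 6 lambda_l)]. *)
Lemma curl_phi_face l k y :
  is_curl (phi_face x n l k) y
    ((2 - 6 * lam l y) *: cross (n l) (g (face_vtx l k))).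
Proof.
set m := face_vtx l k.
rewrite (funext (phi_faceE l k)) -/m.
have hl : has_grad (fun z =>
      height l / 4 * (8 * lam l z - 3) * (lam m z - 4^-1) + height l / 16) y
    (height l / 4 *:
      ((8 * (lam m y - 4^-1)) *: g l + (8 * lam l y - 3) *: g m)).
  apply: (has_grad_quadratic
    (b := fun v => height l * 2 * dot (g l) v * dot (g m) v)) => v h.
  by rewrite !lambda_affine !dotZr dotZl dotDl !dotZl; field.
have hm : has_grad (fun z =>
      height l * 3 / 16 - height l / 4 * (8 * lam l z - 3) * (lam l z - 4^-1)) y
    (- (height l / 4 * (16 * lam l y - 5)) *: g l).
  apply: (has_grad_quadratic
    (b := fun v => - height l * 2 * dot (g l) v ^+ 2)) => v h.
  by rewrite !lambda_affine !dotZr dotZl; field.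
have := is_curlD (is_curl_scale (g l) hl) (is_curl_scale (g m) hm).
congr is_curl; rewrite normal_grad.
by apply: row3P; rewrite !coordE; field.
Qed.

Definition grad_comb i j l : 'rV[R]_3 :=
  coef1 x n i j l *: g (face_vtx l 0) + coef2 x n i j l *: g (face_vtx l 1).

(** The closed form of the curl of [phi_edge], see [curl_phi_edge]. *)
Definition curl_edge i j y : 'rV[R]_3 :=
  2 *: cross (g i) (g j) + \sum_l (2 - 6 * lam l y) *:
    cross (n l) (grad_comb i j l).

Lemma curl_phi_edge i j y : curl (phi_edge x n i j) y = curl_edge i j y.
Proof.
apply: curlE; rewrite /phi_edge /curl_edge; apply: is_curlD.
  have := is_curlD (is_curl_scale (g j) (has_grad_lambda i y))
    (is_curlZ (-1) (is_curl_scale (g i) (has_grad_lambda j y))).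
  congr is_curl; first by apply/funext => z; rewrite scaleN1r.
  by apply: row3P; rewrite !coordE; ring.
apply: is_curl_sum => l.
have := is_curlD (is_curlZ (coef1 x n i j l) (curl_phi_face l 0 y))
    (is_curlZ (coef2 x n i j l) (curl_phi_face l 1 y)).
by congr is_curl; apply: row3P; rewrite /grad_comb !coordE; ring.
Qed.

(** This is where the values of the coefficients [coef1] and [coef2] matter:
    on [F_l] the curl of the Whitney part and the curl of the corrections
    attached to [F_l] have opposite tangential traces. *)
Lemma cross_cross_grad_normal i j l :
  cross (cross (g j) (g i)) (n l) =
  cross (cross (n l) (grad_comb i j l)) (n l).
Proof.
rewrite /grad_comb.
set g1 := g (face_vtx l 0); set g2 := g (face_vtx l 1).
set D := dot (cross g1 g2) (n l).
have D0 : D != 0.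
  rewrite /D normal_grad dotZr mulf_neq0 ?height_neq0 //.
  apply: triple_neq0; rewrite ?face_vtx_neq // /face_vtx.
  by rewrite (inj_eq (@lift_inj _ _)).
have D' : dot (cross g2 g1) (n l) = - D.
  by rewrite crossC -scaleN1r dotZl mulN1r.
apply: (scalerI D0).
rewrite /D (tangential_decomposition _ _ _ (normal_unit l)) -/D.
rewrite /coef1 /coef2 -/g1 -/g2 -/D D'.
set c1 := dot _ (cross (cross (n l) g1) _).
set c2 := dot _ (cross (cross (n l) g2) _).
apply: row3P; rewrite !coordE; field; exact: D0.
Qed.

Lemma sum_lambda_face r l :
  \sum_k lam l (x (face_vtx r k)) = 1 - (l == r)%:R.
Proof.
have := sum_lambda_vertex l.
rewrite (bigD1_ord r) //= lambda_vertex => h.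
by apply: (addrI (l == r)%:R); rewrite [LHS]h; ring.
Qed.

Lemma curl_edge_affine i j (a b c : 'rV[R]_3) s t :
  curl_edge i j (a + s *: (b - a) + t *: (c - a)) =
  (1 - s - t) *: curl_edge i j a + s *: curl_edge i j b + t *: curl_edge i j c.
Proof.
pose S y := \sum_l (2 - 6 * lam l y) *: cross (n l) (grad_comb i j l).
have hS : S (a + s *: (b - a) + t *: (c - a)) =
    (1 - s - t) *: S a + s *: S b + t *: S c.
  rewrite /S !scaler_sumr -!big_split; apply: eq_bigr => l _ /=.
  rewrite !lambda_affine !dotZr !dot_grad_lambda.
  by apply: row3P; rewrite !coordE; ring.
rewrite /curl_edge -!/(S _) hS.
by apply: row3P; rewrite !coordE; ring.
Qed.

(** Summed over the vertices of [F_r], the factor [2 - 6 lambda_l] gives 0 for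
    [l <> r] and 6 for [l = r]. *)
Lemma curl_edge_face_mean i j r :
  cross (\sum_k curl_edge i j (x (face_vtx r k))) (n r) = 0.
Proof.
have -> : \sum_k curl_edge i j (x (face_vtx r k)) = 6 *: (cross (g i) (g j) +
  cross (n r) (grad_comb i j r)).
  rewrite /curl_edge big_split /= sumr_const card_ord exchange_big /=.
  rewrite (bigD1 r) //= [X in _ + (_ + X)]big1 => [|l /negPf lr].
    rewrite -scaler_suml sumrB -mulr_sumr sum_lambda_face eqxx.
    rewrite sumr_const card_ord.
    rewrite -[_ *: _ *+ 3]scaler_nat [true%:R]/=.
    by apply: row3P; rewrite !coordE; ring.
  rewrite -scaler_suml sumrB -mulr_sumr sum_lambda_face lr sumr_const card_ord.
  by rewrite (_ : _ - _ = 0) ?scale0r //=; ring.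
rewrite crossZl crossDl -cross_cross_grad_normal -crossDl.
by rewrite (crossC (g j)) subrr; apply: row3P; rewrite !coordE; ring.
Qed.

Lemma M_face_phi_edge i j r : M_face x n r (phi_edge x n i j) = 0.
Proof.
apply/rowP => k; rewrite mxE [RHS]mxE.
rewrite (_ : (fun y => _) = fun y => cross (curl_edge i j y) (n r) 0 k).
  2: by apply/funext => y; rewrite curl_phi_edge.
have lin (s1 s2 s3 : R) a b c :
  cross (s1 *: a + s2 *: b + s3 *: c) (n r) 0 k =
    s1 * cross a (n r) 0 k + s2 * cross b (n r) 0 k + s3 * cross c (n r) 0 k.
  by rewrite !crossDl !crossZl !mxDE !mxZE.
rewrite triangle_int_affine => [|s t]; last by rewrite curl_edge_affine lin.
have := congr1 (fun u : 'rV[R]_3 => u 0 k) (curl_edge_face_mean i j r).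
rewrite sum3E mx0E -[X in X + _ + _]scale1r -[X in _ + X + _]scale1r.
by rewrite -[X in _ + _ + X]scale1r lin !mul1r => ->; rewrite !mulr0.
Qed.

(** With [d_l], [d_m] the increments of [lambda_l], [lambda_m] along the edge,
    the quadratic part of the tangential component is a multiple of
    [(8 lambda_l - 3) ((lambda_m - 1/4) d_l - (lambda_l - 1/4) d_m)], whose
    second factor is constant along the edge.  That the midpoint value is 0
    is checked for each position of the vertices [l] and [m] on the edge. *)
Lemma edge_mean_phi_face p q l k : p != q ->
  edge_mean x p q (phi_face x n l k) 0.
Proof.
move=> pq; set m := face_vtx l k.
have ml : (m == l) = false by exact: face_vtx_neq.
pose d (r : 'I_4) : R := (r == q)%:R - (r == p)%:R.
pose e (r : 'I_4) : R := (r == p)%:R.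
exists (2 * height l * d l * ((e m - 4^-1) * d l - (e l - 4^-1) * d m)) => s.
rewrite phi_faceE -/m dotDl !dotZl !lambda_affine !dotZr !dot_grad_edge.
rewrite !lambda_vertex /d /e.
case: (eqVneq l p) => lp; case: (eqVneq l q) => lq;
  case: (eqVneq m p) => mp; case: (eqVneq m q) => mq; rewrite /=.
all: first [ by field
  | by rewrite -lp -lq eqxx in pq | by rewrite -mp -mq eqxx in pq
  | by rewrite lp mp eqxx in ml | by rewrite lq mq eqxx in ml ].
Qed.

(** In the tangential component of the Whitney part the terms linear in the arc
    parameter cancel, leaving a constant, and each face function adds 0 by
    [edge_mean_phi_face]. *)
Lemma edge_mean_phi_edge p q i j : p != q ->
  edge_mean x p q (phi_edge x n i j)
    ((i == p)%:R * (j == q)%:R - (j == p)%:R * (i == q)%:R).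
Proof.
move=> pq; rewrite -[X in edge_mean _ _ _ _ X]addr0 /phi_edge.
apply: edge_meanD.
  exists 0 => s; rewrite dotBl !dotZl !lambda_affine !dotZr !dot_grad_edge.
  by rewrite !lambda_vertex; ring.
rewrite -[X in edge_mean _ _ _ _ X](@big1_eq _ 0 +%R 'I_4 (index_enum _)
  xpredT).
apply: edge_mean_sum => l.
have := edge_meanD (edge_meanZ (coef1 x n i j l) (edge_mean_phi_face l 0 pq))
  (edge_meanZ (coef2 x n i j l) (edge_mean_phi_face l 1 pq)).
by rewrite !mulr0 addr0.
Qed.

End Tetrahedron.

Theorem lemma2p5 (R : realType) (x n : 'I_4 -> 'rV[R]_3)
    (hK : nondegenerate x)
    (hn : forall l : 'I_4, outward_unit_normal x l (n l))
    (i j : 'I_4) (hij : (i < j)%N) :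
  [/\ M_edge x i j (phi_edge x n i j) = 1,
      forall p q : 'I_4, (p < q)%N -> (p, q) != (i, j) ->
        M_edge x p q (phi_edge x n i j) = 0
    & forall l : 'I_4, M_face x n l (phi_edge x n i j) = 0].
Proof.
have M_edge_phi (p q : 'I_4) : (p < q)%N -> M_edge x p q (phi_edge x n i j) =
    (i == p)%:R * (j == q)%:R - (j == p)%:R * (i == q)%:R.
  move=> pq; have pq' : p != q by rewrite -val_eqE neq_ltn pq.
  apply: M_edgeE; first by rewrite (inj_eq (vertex_inj hK)).
  exact: edge_mean_phi_edge.
split=> [|p q pq|l]; last exact: M_face_phi_edge.
  rewrite M_edge_phi // !eqxx -[j == i]val_eqE (gtn_eqF hij).
  by rewrite /= mul0r mulr1 subr0.
rewrite xpair_eqE M_edge_phi // [i == p]eq_sym [j == q]eq_sym.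
move=> /negbTE pq_ij; rewrite -[_ * _]natrM mulnb pq_ij sub0r.
(* As p < q and i < j, the reversed edge (p, q) = (j, i) cannot occur. *)
have [jp|_] := eqVneq j p; have [iq|_] := eqVneq i q;
  rewrite ?mulr0 ?mul0r ?oppr0 //.
by move: pq hij; rewrite -jp -iq => /ltnW; rewrite leqNgt => /negPf->.
Qed.
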